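(* Let $P_0>0$, let $\mathbf{K}\in\mathbb{R}^{nK\times nK}$ and $\mathbf{S}\in\mathbb{C}^{r\times r}$ be positive definite covariance matrices, let $\mathbf{H}\in\mathbb{C}^{r\times mK}$, and let $\mathbf{Q}=[\mathbf{I},\ldots,\mathbf{I}]\in\mathbb{R}^{n\times nK}$ ($K$ copies of the $n\times n$ identity matrix). Let $$\mathbf{K}=\mathbf{U}\mathbf{\Delta}\mathbf{U}^{\mathrm T},\qquad \mathbf{H}^{\mathrm H}\mathbf{S}^{-1}\mathbf{H}=\mathbf{V}\mathbf{\Lambda}\mathbf{V}^{\mathrm H}$$ be eigenvalue decompositions, where $\mathbf{U}\in\mathbb{R}^{nK\times nK}$ and $\mathbf{V}\in\mathbb{C}^{mK\times mK}$ are unitary, $\mathbf{\Delta}=\mathrm{diag}(\delta_1,\ldots,\delta_{nK})$ with $\delta_1\ge\cdots\ge\delta_{nK}\ge 0$, and $\mathbf{\Lambda}=\mathrm{diag}(\lambda_1,\ldots,\lambda_{mK})$ with $\lambda_1\ge\cdots\ge\lambda_{mK}\ge 0$ (so that $\lambda_{r+1}=\cdots=\lambda_{mK}=0$ when $r<mK$). Consider the problem $(\mathcal{P}2')$ $$\min_{\mathbf{A}}\ \mathrm{Tr}\left[\mathbf{Q}\left(\mathbf{K}^{-1}+\mathbf{A}^{\mathrm H}\mathbf{H}^{\mathrm H}\mathbf{S}^{-1}\mathbf{H}\mathbf{A}\right)^{-1}\mathbf{Q}^{\mathrm T}\right]\quad\text{s.t.}\quad \mathrm{Tr}[\mathbf{A}\mathbf{K}\mathbf{A}^{\mathrm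 H}]=P_0,$$ where the matrix variable $\mathbf{A}\in\mathbb{C}^{mK\times nK}$ is assumed to be decomposed as $$\mathbf{A}=\mathbf{V}\mathbf{\Phi}\mathbf{U}^{\mathrm T},\qquad \mathbf{\Phi}=\begin{bmatrix}\mathrm{diag}(\phi_1,\ldots,\phi_{mK}) & \mathbf{O}\end{bmatrix},$$ with scalar parameters $\phi_1,\ldots,\phi_{mK}$ (satisfying $|\phi_j|^2\ge 0$), so that the solution is determined by these $mK$ parameters. Then the solution of $(\mathcal{P}2')$ is given by the following water-filling form: $$|\hat\phi_j|^2=\begin{cases}\dfrac{1}{\delta_j\lambda_j}\left(\sqrt{\dfrac{\delta_j\lambda_jR_j}{\mu}}-1\right)^+, & j=1,\ldots,\min(r,mK),\\[3mm] 0, & j=\min(r,mK)+1,\ldots,mK,\end{cases}$$ where $R_j=\sum_{i=1}^n([\mathbf{Q}\mathbf{U}]_{ij})^2$, $[\mathbf{Q}\mathbf{U}]_{ij}$ is the $(i,j)$th element of $\mathbf{Q}\mathbf{U}$, and $\mu\in\mathbb{R}$ is determined to satisfy the power constraint $\mathrm{Tr}[\mathbf{A}\mathbf{K}\mathbf{A}^{\mathrm H}]=P_0$ of the problem. For the case $j=1,\ldots,\min(r,mK)$, if the quantities inside $(\cdot)^+$ on the right-hand side above are nonnegative for all $j$, the solution is given by $$\hat\phi_j=\sqrt{\frac{1}{\delta_j\lambda_j}\left(\sqrt{\delta_j\lambda_jR_j}\;\frac{P_0+\sum_{l=1}^{\min(r,mK)}\frac{1}{\lambda_l}}{\sum_{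l=1}^{\min(r,mK)}\sqrt{\frac{\delta_lR_l}{\lambda_l}}}-1\right)}.$$
   Context: For $\alpha\in\mathbb{R}$, $(\alpha)^+=\max(0,\alpha)$. Superscripts $\mathrm T$ and $\mathrm H$ denote transpose and Hermitian transpose; $\mathrm{Tr}$ is the trace; $\mathbf{O}$ is a zero matrix. The bold $\mathbf{K}$ (a covariance matrix of size $nK\times nK$) is distinct from the integer $K$ (number of sensor nodes). In the underlying model, $K,m,n,r$ are positive integers: $m$ is the number of transmit antennas per node, $n$ the number of measurements per node, $r$ the number of receive antennas at the aggregator. $\mathbf{H}$ is the concatenated channel matrix, $\mathbf{S}$ the noise covariance, $\mathbf{K}$ the covariance of the stacked vector of the nodes' pre-processed data, $\mathbf{A}$ the precoder (with no block-diagonal constraint in this relaxed problem), and $P_0$ the total transmit power. The objective is the mean squared error of the linear MMSE estimate of the sum of the nodes' vectors.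
   Formalization: Existence of μ is claimed only if some λ_jR_j > 0 (otherwise the formula gives φ = 0, no μ meets the power constraint, and the claim fails); where λ_j = 0 with j ≤ min(r,mK), so that 1/(δ_jλ_j) is undefined, the value of |φ_j|² is taken to be 0. *)

(* Defs.v *)
From HB Require Import structures.
From mathcomp Require Import all_boot all_order all_algebra.
From mathcomp Require Import sesquilinear spectral.
From mathcomp Require Import reals.
From mathcomp Require Export complex.

Set Implicit Arguments.
Unset Strict Implicit.
Unset Printing Implicit Defensive.

Import Order.TTheory GRing.Theory Num.Theory.
Local Open Scope ring_scope.
Local Open Scope complex_scope.
Local Open Scope sesquilinear_scope.

Definition cplx_mx (R : realType) (p q : nat) (A : 'M[R]_(p, q)) :
    'M[R[i]]_(p, q) :=
  map_mx (real_complex R) A.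

Definition real_posdef (R : realType) (p : nat) (A : 'M[R]_p) : Prop :=
  A \is symmetricmx /\
  forall x : 'cV[R]_p, x != 0 -> 0 < (x^T *m A *m x) 0 0.

(* In R[i], [0 < z] means that z is real and positive. *)
Definition cplx_posdef (R : realType) (p : nat) (A : 'M[R[i]]_p) : Prop :=
  A \is hermsymmx /\
  forall x : 'cV[R[i]]_p, x != 0 -> 0 < (x ^t* *m A *m x) 0 0.

Definition nonincreasing_nonneg (R : realType) (p : nat) (d : 'rV[R]_p) :
    Prop :=
  (forall j, 0 <= d 0 j) /\
  forall i j : 'I_p, (i <= j)%N -> d 0 j <= d 0 i.

(* Column j belongs to block j %/ n, where it has position j %% n. *)
Definition Qmx (R : realType) (n K : nat) : 'M[R]_(n, n * K) :=
  \matrix_(i < n, j < n * K) ((j %% n)%N == i)%:R.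

Definition mse (R : realType) (K m n r : nat) (Kcov : 'M[R]_(n * K))
    (S : 'M[R[i]]_r) (H : 'M[R[i]]_(r, m * K))
    (A : 'M[R[i]]_(m * K, n * K)) : R[i] :=
  \tr (cplx_mx (Qmx R n K)
       *m invmx (invmx (cplx_mx Kcov)
                 + A ^t* *m H ^t* *m invmx S *m H *m A)
       *m (cplx_mx (Qmx R n K))^T).

Definition power (R : realType) (M N : nat) (Kcov : 'M[R]_N)
    (A : 'M[R[i]]_(M, N)) : R[i] :=
  \tr (A *m cplx_mx Kcov *m A ^t*).

(* The matrix [diag(phi) O]; the block form presupposes M <= N. *)
Definition Phimx (R : realType) (M N : nat) (phi : 'rV[R[i]]_M) :
    'M[R[i]]_(M, N) :=
  \matrix_(i < M, j < N) (phi 0 i *+ (i == j :> nat)).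

Definition precoder (R : realType) (M N : nat) (U : 'M[R]_N)
    (V : 'M[R[i]]_M) (phi : 'rV[R[i]]_M) : 'M[R[i]]_(M, N) :=
  V *m Phimx N phi *m (cplx_mx U)^T.

Definition feasible (R : realType) (M N : nat) (P0 : R) (Kcov U : 'M[R]_N)
    (V : 'M[R[i]]_M) (phi : 'rV[R[i]]_M) : Prop :=
  power Kcov (precoder U V phi) = P0%:C.

(* In R[i], [z <= w] means that w - z is real and nonnegative. *)
Definition is_solution (R : realType) (K m n r : nat) (P0 : R)
    (Kcov : 'M[R]_(n * K)) (S : 'M[R[i]]_r) (H : 'M[R[i]]_(r, m * K))
    (U : 'M[R]_(n * K)) (V : 'M[R[i]]_(m * K)) (phi : 'rV[R[i]]_(m * K)) :
    Prop :=
  feasible P0 Kcov U V phi /\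
  forall psi : 'rV[R[i]]_(m * K), feasible P0 Kcov U V psi ->
    mse Kcov S H (precoder U V phi) <= mse Kcov S H (precoder U V psi).

Definition Rgain (R : realType) (n K : nat) (U : 'M[R]_(n * K))
    (j : 'I_(n * K)) : R :=
  \sum_(i < n) ((Qmx R n K *m U) i j) ^+ 2.

Definition node_ord (K m n : nat) (hmn : (m <= n)%N) (j : 'I_(m * K)) :
    'I_(n * K) :=
  widen_ord (leq_mul hmn (leqnn K)) j.

Section WaterFilling.
Context (R : realType) (K m n r : nat) (hmn : (m <= n)%N).
Context (delta : 'rV[R]_(n * K)) (lambda : 'rV[R]_(m * K)).
Context (U : 'M[R]_(n * K)).

Local Notation del j := (delta 0 (node_ord hmn j)).
Local Notation lam j := (lambda 0 j).
Local Notation gain j := (Rgain U (node_ord hmn j)).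

(* The quantity whose positive part is taken in the water-filling formula. *)
Definition wf_inner (mu : R) (j : 'I_(m * K)) : R :=
  Num.sqrt (del j * lam j * gain j / mu) - 1.

(* Indices start at 0, so the range 1, ..., min(r, mK) reads
   j < minn r (m * K).  When lam j = 0 the positive part vanishes, so the value
   is 0 whatever the convention for division by 0. *)
Definition wf_sqr (mu : R) (j : 'I_(m * K)) : R :=
  if (j < minn r (m * K))%N then
    1 / (del j * lam j) * Num.max 0 (wf_inner mu j)
  else 0.

Definition is_waterfilling (mu : R) (phi : 'rV[R[i]]_(m * K)) : Prop :=
  forall j, `|phi 0 j| ^+ 2 = (wf_sqr mu j)%:C.

(* mu is determined by the power constraint, which depends on phi only through
   the squared moduli of its entries. *)
Definition water_level (P0 : R) (Kcov : 'M[R]_(n * K))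
    (V : 'M[R[i]]_(m * K)) (mu : R) : Prop :=
  0 < mu /\ forall phi, is_waterfilling mu phi -> feasible P0 Kcov U V phi.

Definition wf_closed (P0 : R) : 'rV[R[i]]_(m * K) :=
  \row_j
    (if (j < minn r (m * K))%N then
       Num.sqrt (1 / (del j * lam j) *
         (Num.sqrt (del j * lam j * gain j) *
          ((P0 + \sum_(l < m * K | (l < minn r (m * K))%N) 1 / lam l) /
           (\sum_(l < m * K | (l < minn r (m * K))%N)
              Num.sqrt (del l * gain l / lam l))) - 1))
     else 0)%:C.

End WaterFilling.

(* Main.v *)
Require Import Defs.
From HB Require Import structures.
From mathcomp Require Import all_boot all_order all_algebra.
From mathcomp Require Import sesquilinear spectral.
From mathcomp Require Import reals complex.
From mathcomp Require Import ring lra.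

(* In the bases U and V everything is diagonal: with x_j = |phi_j|^2 the
   objective is a constant plus \sum_j delta_j R_j / (1 + delta_j lambda_j x_j)
   and the constraint is \sum_j delta_j x_j = P0.  For mu > 0 the Lagrangian
   splits into one-variable functions, each with the water-filling value as its
   strict minimum on [0, +oo), which yields optimality and uniqueness at once.
   The power spent by the water-filling is a piecewise linear function of
   1 / sqrt mu, strictly increasing where it is positive, so the level exists
   and is unique.  When no term is cut off by the positive part the function is
   affine, and solving for 1 / sqrt mu gives the closed form.  The bound
   rank (H^H S^-1 H) <= r forces lambda_j = 0 for j > r. *)

Set Implicit Arguments.
Unset Strict Implicit.
Unset Printing Implicit Defensive.

Import Order.TTheory GRing.Theory Num.Theory.
Local Open Scope ring_scope.
Local Open Scope complex_scope.
Local Open Scope sesquilinear_scope.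

(** * One-variable water-filling and the equation for its level *)

Definition wf_level (R : realType) (d l g mu : R) : R :=
  1 / (d * l) * Num.max 0 (Num.sqrt (d * l * g / mu) - 1).

Lemma wf_level_ge0 (R : realType) (d l g mu : R) :
  0 <= d -> 0 <= l -> 0 <= wf_level d l g mu.
Proof.
by move=> d0 l0; rewrite mulr_ge0 ?divr_ge0 ?mulr_ge0 // le_max lexx.
Qed.

(** The convention 0^-1 = 0 makes [wf_level] reproduce the cut-off of [wf_sqr] at vanishing
    eigenvalues. *)
Lemma wf_level_l0 (R : realType) (d g mu : R) : wf_level d 0 g mu = 0.
Proof. by rewrite /wf_level mulr0 !mul0r invr0 !mulr0 mul0r. Qed.

Definition lagrangian (R : realType) (d l g mu x : R) : R :=
  d * g / (1 + d * l * x) + mu * (d * x).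

(** For l > 0, put y = 1 + d l x >= 1: a / y + y decreases up to sqrt a and increases afterwards, so
    its minimiser is the larger of 1 and sqrt a. The equality case later yields uniqueness. *)
Lemma lagrangian_min (R : realType) (d l g mu x : R) :
  0 < d -> 0 <= l -> 0 <= g -> 0 < mu -> 0 <= x ->
  lagrangian d l g mu (wf_level d l g mu) <= lagrangian d l g mu x
    ?= iff (x == wf_level d l g mu).
Proof.
move=> d0 l0 g0 mu0 x0; apply/leifP.
have [->|xw] := eqVneq x; first by [].
rewrite -subr_gt0.
(* Here the Lagrangian is affine in [x] with slope [mu * d > 0]. *)
have [lE|l_neq0] := eqVneq l 0.
  move: xw; rewrite lE wf_level_l0 /lagrangian mulr0 !mul0r !mulr0 addr0.
  move=> xw; have xp : 0 < x by rewrite lt_def xw.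
  by rewrite addr0 addrAC subrr add0r !mulr_gt0.
have lp : 0 < l by rewrite lt_def l_neq0.
have dl : 0 < d * l by rewrite mulr_gt0.
set a := d * l * g / mu.
have a0 : 0 <= a by rewrite !mulr_ge0 ?invr_ge0 // ltW.
pose y := 1 + d * l * x; pose w := wf_level d l g mu.
pose yw := 1 + d * l * w.
have y1 : 1 <= y by rewrite lerDl mulr_ge0 // ltW.
have ywE : yw = Num.max 1 (Num.sqrt a).
  rewrite /yw /w /wf_level mulrA div1r divff ?gt_eqF // mul1r.
  by rewrite addr_maxr addr0 addrC subrK.
have yyw : y != yw.
  apply: contra_neq xw => /addrI /mulfI; apply; exact: lt0r_neq0.
have yw1 : 1 <= yw by rewrite ywE le_max lexx.
(* In terms of [y = 1 + d l x] the Lagrangian is [(mu / l) (a / y + y - 1)]. *)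
have LE z : lagrangian d l g mu z
    = mu / l * (a / (1 + d * l * z) + (1 + d * l * z) - 1).
  rewrite /lagrangian /a; move: (_ + _)^-1 => u.
  by field; rewrite !gt_eqF.
rewrite !LE -/y -/yw -mulrBr pmulr_rgt0 ?divr_gt0 //.
have yp : 0 < y by exact: lt_le_trans ltr01 y1.
have ywp : 0 < yw by exact: lt_le_trans ltr01 yw1.
rewrite opprB addrA subrK.
(* Either sqrt a is admissible and the gap is a square over [y], or the minimiser is clipped to 1
   and the gap factors with a < 1 < y. *)
have [s1|s1] := leP 1 (Num.sqrt a).
  have ywS : a = yw ^+ 2 by rewrite ywE max_r // sqr_sqrtr.
  have -> : a / y + y - (a / yw + yw) = (y - yw) ^+ 2 / y.
    by rewrite ywS; field; rewrite !gt_eqF.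
  by rewrite divr_gt0 // exprn_even_gt0 //= subr_eq0.
have yw1E : yw = 1 by rewrite ywE max_l // ltW.
have -> : a / y + y - (a / yw + yw) = (y - 1) * (y - a) / y.
  by rewrite yw1E; field; rewrite !gt_eqF.
have yg : 1 < y by rewrite lt_def y1 andbT -yw1E.
have a1 : a < 1 by rewrite -[a]sqr_sqrtr // expr_lt1 ?sqrtr_ge0.
by rewrite divr_gt0 // mulr_gt0 // subr_gt0 // (lt_trans a1).
Qed.

(** In t = 1 / sqrt mu the power of one coordinate is piecewise linear. *)
Lemma mul_wf_level (R : realType) (d l g mu : R) :
  0 < d -> 0 <= l -> 0 <= g -> 0 < mu ->
  d * wf_level d l g mu
  = l^-1 * Num.max 0 (Num.sqrt (d * l * g) * (Num.sqrt mu)^-1 - 1).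
Proof.
move=> d0 l0 g0 mu0; rewrite /wf_level sqrtrM ?sqrtrV; last first.
- by rewrite ?mulr_ge0 // ltW.
- exact: ltW.
by rewrite mulrA div1r invfM mulrA divff ?mul1r // gt_eqF.
Qed.

(* The sum is the maximum over [A] of the linear functions
   [\sum_(i in A) c i * (a i * t - 1)], so the least of the times at which
   these functions reach [P] is the one we want. *)
Lemma exists_level (R : realFieldType) (I : finType) (c a : I -> R) (P : R) :
  0 < P -> (forall i, 0 <= c i) -> (forall i, 0 <= a i) ->
  (exists i, 0 < c i * a i) ->
  exists2 t, 0 < t & \sum_i c i * Num.max 0 (a i * t - 1) = P.
Proof.
move=> P0 c0 a0 [i0 ca0].
pose slope (A : {set I}) := \sum_(i in A) c i * a i.
pose mass (A : {set I}) := \sum_(i in A) c i.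
have slope_ge0 A : 0 <= slope A by apply: sumr_ge0 => i _; rewrite mulr_ge0.
have mass_ge0 A : 0 <= mass A by apply: sumr_ge0.
have slope_i0 : 0 < slope [set i0] by rewrite /slope big_set1.
pose time A := (P + mass A) / slope A.
have linE (A : {set I}) t :
    \sum_(i in A) c i * (a i * t - 1) = slope A * t - mass A.
  rewrite mulr_suml -sumrB; apply: eq_bigr => i _.
  by rewrite mulrBr mulrA mulr1.
have [A sA minA] :=
  @arg_minP _ _ _ [set i0] (fun A => 0 < slope A) time slope_i0.
exists (time A); first by rewrite divr_gt0 // ltr_wpDr.
set t := time A; apply/eqP; rewrite eq_le; apply/andP; split.
  (* [B] holds the terms not cut off at time [t]. If its slope is positive, it cannot reach [P]
     before [A] does. *)
  pose B := [set i | 1 <= a i * t].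
  have -> : \sum_i c i * Num.max 0 (a i * t - 1)
      = \sum_(i in B) c i * (a i * t - 1).
    rewrite [RHS]big_mkcond; apply: eq_bigr => i _; rewrite inE -subr_ge0.
    by have [|/ltW] := leP 0 (a i * t - 1); rewrite ?mulr0.
  rewrite linE lerBlDr; have [sB|] := ltP 0 (slope B).
    by rewrite mulrC -ler_pdivlMr //; exact: minA.
  move=> sB; have -> : slope B = 0 by apply/eqP; rewrite eq_le sB slope_ge0.
  by rewrite mul0r addr_ge0 // ltW.
(* Conversely, [A] reaches [P] exactly at [t], and positive parts only increase the sum. *)
have -> : P = \sum_(i in A) c i * (a i * t - 1).
  by rewrite linE /t /time mulrC divfK ?gt_eqF // addrK.
rewrite big_mkcond; apply: ler_sum => i _; case: ifP => _.
  by rewrite ler_wpM2l // le_max lexx orbT.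
by rewrite mulr_ge0 // le_max lexx.
Qed.

(** * The separable problem over a finite index set *)

Section LevelSum.
Context (R : realType) (I : finType) (d l g : I -> R) (P : R).
Hypotheses (d_gt0 : forall i, 0 < d i) (l_ge0 : forall i, 0 <= l i)
  (g_ge0 : forall i, 0 <= g i) (P_gt0 : 0 < P).

Lemma level_sumE mu : 0 < mu ->
  \sum_i d i * wf_level (d i) (l i) (g i) mu
  = \sum_i (l i)^-1
      * Num.max 0 (Num.sqrt (d i * l i * g i) * (Num.sqrt mu)^-1 - 1).
Proof. by move=> mu0; apply: eq_bigr => i _; rewrite mul_wf_level. Qed.

(** If [l i * g i] vanished for every [i], all levels would be 0 and could not spend [P]. The
    witness inverts t = 1 / sqrt mu. *)
Lemma level_sum_exists : (exists i, 0 < l i * g i) ->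
  exists2 mu, 0 < mu & \sum_i d i * wf_level (d i) (l i) (g i) mu = P.
Proof.
move=> [i0 lg0].
have [|||t t0 tP] := @exists_level R I (fun i => (l i)^-1)
  (fun i => Num.sqrt (d i * l i * g i)) P P_gt0.
- by move=> i; rewrite invr_ge0.
- by move=> i; exact: sqrtr_ge0.
- exists i0; rewrite mulr_gt0 //; last by rewrite sqrtr_gt0 -mulrA mulr_gt0.
  rewrite invr_gt0 lt_def l_ge0 andbT.
  by apply: contraTneq lg0 => ->; rewrite mul0r ltxx.
exists (t ^- 2); first by rewrite invr_gt0 exprn_gt0.
rewrite level_sumE ?invr_gt0 ?exprn_gt0 //.
by rewrite sqrtrV ?sqrtr_sqr ?sqr_ge0 // invrK ger0_norm // ltW.
Qed.

(** Every term is nonincreasing in the level. As [P] is positive, some term is positive at [nu], and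
    that one grows strictly when the level drops. *)
Lemma level_sum_lt mu nu : 0 < mu -> mu < nu ->
  \sum_i d i * wf_level (d i) (l i) (g i) nu = P ->
  P < \sum_i d i * wf_level (d i) (l i) (g i) mu.
Proof.
move=> mu0 munu nuP; have nu0 : 0 < nu by exact: lt_trans munu.
have inv_lt : (Num.sqrt nu)^-1 < (Num.sqrt mu)^-1.
  by rewrite ltf_pV2 ?posrE ?sqrtr_gt0 // ltr_sqrt.
have le_lvl i : d i * wf_level (d i) (l i) (g i) nu
    <= d i * wf_level (d i) (l i) (g i) mu.
  rewrite !mul_wf_level // ler_wpM2l ?invr_ge0 // le_max2 // lerB //.
  by rewrite ler_wpM2l ?sqrtr_ge0 // ltW.
have [i0 lvl0] : exists i, 0 < d i * wf_level (d i) (l i) (g i) nu.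
  apply/existsP; apply: contraTT P_gt0; rewrite negb_exists => /forallP lvl0.
  by rewrite -nuP -leNgt sumr_le0 // => i _; rewrite leNgt.
rewrite -nuP (bigD1 i0) // [X in _ < X](bigD1 i0) //= ltr_leD //; last first.
  exact: ler_sum.
move: lvl0; rewrite !mul_wf_level //.
have [->|l_neq0] := eqVneq (l i0) 0; first by rewrite invr0 mul0r ltxx.
have lV0 : 0 < (l i0)^-1 by rewrite invr_gt0 lt_def l_neq0 l_ge0.
rewrite pmulr_rgt0 // lt_max ltxx /= => lvl0.
rewrite ltr_pM2l // (max_r (ltW lvl0)) lt_max; apply/orP; right.
rewrite ltrD2r ltr_pM2l // lt_def sqrtr_ge0 andbT.
by apply: contraTneq lvl0 => ->; rewrite mul0r sub0r oppr_gt0 ltr10.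
Qed.

Lemma level_sum_inj mu nu : 0 < mu -> 0 < nu ->
  \sum_i d i * wf_level (d i) (l i) (g i) mu = P ->
  \sum_i d i * wf_level (d i) (l i) (g i) nu = P -> mu = nu.
Proof.
move=> mu0 nu0 muP nuP; have [lt|lt|//] := ltgtP mu nu.
  by have := level_sum_lt mu0 lt nuP; rewrite muP ltxx.
by have := level_sum_lt nu0 lt muP; rewrite nuP ltxx.
Qed.

(** Sum the one-variable inequalities: both points spend [P], so the multiplier terms cancel and the
    objectives remain. *)
Lemma level_sum_minP mu (x : I -> R) : 0 < mu ->
  \sum_i d i * wf_level (d i) (l i) (g i) mu = P ->
  (forall i, 0 <= x i) -> \sum_i d i * x i = P ->
  \sum_i d i * g i / (1 + d i * l i * wf_level (d i) (l i) (g i) mu)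
    <= \sum_i d i * g i / (1 + d i * l i * x i)
    ?= iff [forall i, x i == wf_level (d i) (l i) (g i) mu].
Proof.
move=> mu0 muP x0 xP.
have sumL y : \sum_i d i * y i = P ->
    \sum_i lagrangian (d i) (l i) (g i) mu (y i)
    = \sum_i d i * g i / (1 + d i * l i * y i) + mu * P.
  by move=> <-; rewrite mulr_sumr -big_split.
have := leif_sum (fun i (_ : true) =>
  lagrangian_min (d_gt0 i) (l_ge0 i) (g_ge0 i) mu0 (x0 i)).
by rewrite !sumL // /Order.leif lerD2r (inj_eq (addIr _)).
Qed.

End LevelSum.

(** * Embedding of real matrices, orthogonal diagonalisation and rank *)

Section RealMatrices.
Context (R : realType).

Lemma cplx_mxM p q s (A : 'M[R]_(p, q)) (B : 'M[R]_(q, s)) :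
  cplx_mx (A *m B) = cplx_mx A *m cplx_mx B.
Proof. exact: map_mxM. Qed.

Lemma cplx_mx_tr p q (A : 'M[R]_(p, q)) : cplx_mx A^T = (cplx_mx A)^T.
Proof. by rewrite /cplx_mx map_trmx. Qed.

Lemma cplx_mx_trC p q (A : 'M[R]_(p, q)) : (cplx_mx A) ^t* = cplx_mx A^T.
Proof. by apply/matrixP => i j; rewrite !mxE; exact: conjc_real. Qed.

Lemma cplx_unitary_real p (U : 'M[R]_p) :
  cplx_mx U \is unitarymx -> U *m U^T = 1%:M.
Proof.
move=> /unitarymxP; rewrite cplx_mx_trC -cplx_mxM => UU.
by apply: (map_mx_inj (f := real_complex R)); rewrite map_mx1.
Qed.

Lemma invmx_orthogonal_diag p (U : 'M[R]_p) (d : 'rV[R]_p) :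
  U *m U^T = 1%:M -> (forall j, d 0 j != 0) ->
  invmx (U *m diag_mx d *m U^T)
  = U *m diag_mx (\row_j (d 0 j)^-1) *m U^T.
Proof.
move=> UU d0; have UtU := mulmx1C UU.
have dd : diag_mx d *m diag_mx (\row_j (d 0 j)^-1) = 1%:M.
  rewrite mulmx_diag -diag_const_mx; congr diag_mx.
  by apply/rowP => j; rewrite !mxE divff.
set A := _ *m U^T; set B := RHS.
have AB : A *m B = 1%:M.
  rewrite /A /B -!mulmxA (mulmxA U^T) UtU mul1mx (mulmxA (diag_mx d)) dd.
  by rewrite mul1mx.
have [Au _] := mulmx1_unit AB.
by rewrite -[RHS](mulKmx Au) AB mulmx1.
Qed.

(** Source of the gains R_j: they are the squared column norms of Q U. *)
Lemma trace_sandwich_diag p q (Q : 'M[R]_(p, q)) (U : 'M[R]_q) (d : 'rV[R]_q) :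
  \tr (Q *m (U *m diag_mx d *m U^T) *m Q^T)
  = \sum_j d 0 j * \sum_i ((Q *m U) i j) ^+ 2.
Proof.
have -> : Q *m (U *m diag_mx d *m U^T) *m Q^T
    = (Q *m U) *m diag_mx d *m (Q *m U)^T by rewrite trmx_mul !mulmxA.
rewrite /mxtrace; under eq_bigr do rewrite mxE.
rewrite exchange_big; apply: eq_bigr => j _; rewrite mulr_sumr.
apply: eq_bigr => i _; rewrite mul_mx_diag !mxE.
by rewrite mulrAC mulrC -expr2.
Qed.

(** A nonzero entry at [j] forces all earlier ones to be positive, so the leading block of size j +
    1, cut out by [E], is invertible. *)
Lemma rank_sorted_diag p (d : 'rV[R]_p) (j : 'I_p) :
  nonincreasing_nonneg d -> (\rank (diag_mx d) <= j)%N -> d 0 j = 0.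
Proof.
move=> [d0 d_le] rk; apply/eqP; apply: contraTT rk => dj; rewrite -ltnNge.
pose E : 'M[R]_(j.+1, p) := rowsub (widen_ord (ltn_ord j)) 1%:M.
have EdE : E *m diag_mx d *m E^T
    = diag_mx (\row_i d 0 (widen_ord (ltn_ord j) i)).
  apply/matrixP => i k.
  rewrite mul_mx_diag !mxE (bigD1 (widen_ord (ltn_ord j) i)) //=.
  rewrite big1 => [|l /negbTE li]; last by rewrite !mxE eq_sym li !mul0r.
  by rewrite !mxE eqxx mul1r addr0 -val_eqE /= mulr_natr eq_sym.
have u : E *m diag_mx d *m E^T \in unitmx.
  rewrite EdE unitmxE det_diag unitfE; apply/prodf_neq0 => i _; rewrite mxE.
  apply: lt0r_neq0; apply: lt_le_trans (d_le _ j _).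
    by rewrite lt_def dj d0.
  by rewrite /= -ltnS.
rewrite -[X in (X <= _)%N](mxrank_unit u).
exact: leq_trans (mxrankM_maxl _ _) (mxrankM_maxr _ _).
Qed.

End RealMatrices.

Lemma normsqr_sqrt (R : realType) (x : R) :
  0 <= x -> `|(Num.sqrt x)%:C| ^+ 2 = x%:C.
Proof.
move=> x0; rewrite ger0_norm ?ler0c ?sqrtr_ge0 //.
by rewrite -rmorphXn /= sqr_sqrtr.
Qed.

(** The inner sum is the extension of [y] by zero, which is how the zero block of [Phimx] enters the
    traces. *)
Lemma sum_widen_ord (R : realType) (p q : nat) (h : (p <= q)%N)
    (y : 'I_p -> R) (f : 'I_q -> R -> R) :
  \sum_(j < q) f j (\sum_(i < p) y i *+ (i == j :> nat))
  = \sum_(j < q | ~~ (j < p)%N) f j 0 + \sum_(i < p) f (widen_ord h i) (y i).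
Proof.
rewrite addrC (bigID (fun j : 'I_q => (j < p)%N)) /=; congr (_ + _).
  rewrite (big_ord_narrow h); apply: eq_bigr => i _; congr (f _ _).
  rewrite (bigD1 i) //= eqxx big1 ?addr0 // => k /negbTE.
  by rewrite -val_eqE /= => ->.
apply: eq_bigr => j jp; congr (f _ _); rewrite big1 // => i _.
by case: eqP => // ij; rewrite -ij ltn_ord in jp.
Qed.

(** * Diagonal form of the objective and of the power *)

Section Model.
Context (R : realType) (K m n r : nat) (hmn : (m <= n)%N).
Context (Kcov : 'M[R]_(n * K)) (S : 'M[R[i]]_r) (H : 'M[R[i]]_(r, m * K)).
Context (U : 'M[R]_(n * K)) (delta : 'rV[R]_(n * K)).
Context (V : 'M[R[i]]_(m * K)) (lambda : 'rV[R]_(m * K)).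
Hypotheses (Kcov_pd : real_posdef Kcov)
  (U_unitary : cplx_mx U \is unitarymx) (V_unitary : V \is unitarymx)
  (lambda_ord : nonincreasing_nonneg lambda)
  (Kcov_evd : Kcov = U *m diag_mx delta *m U^T)
  (H_evd : H ^t* *m invmx S *m H
           = V *m cplx_mx (diag_mx lambda) *m V ^t*).

Local Notation del i := (delta 0 (node_ord hmn i)).
Local Notation gain i := (Rgain U (node_ord hmn i)).

Let UUt : U *m U^T = 1%:M := cplx_unitary_real U_unitary.
Let UtU : U^T *m U = 1%:M := mulmx1C UUt.

Let VtV : V ^t* *m V = 1%:M.
Proof. by rewrite -invmx_unitary // mulVmx // unitarymx_unit. Qed.

Let conjU : map_mx Num.conj (cplx_mx U) = cplx_mx U.
Proof. by apply/matrixP => a b; rewrite !mxE; exact: conjc_real. Qed.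

(** Evaluate the quadratic form of [Kcov] at the eigenvector U e_j. *)
Lemma delta_gt0 j : 0 < delta 0 j.
Proof.
have [_ /(_ (U *m delta_mx j 0))] := Kcov_pd.
have -> : (U *m delta_mx j 0)^T *m Kcov *m (U *m delta_mx j (0 : 'I_1))
    = (delta 0 j)%:M.
  rewrite Kcov_evd trmx_mul !mulmxA -(mulmxA _ U^T U) UtU mulmx1.
  rewrite -(mulmxA _ U^T U) UtU mulmx1 trmx_delta mul_mx_diag.
  apply/matrixP => a b; rewrite !ord1 !mxE (bigD1 j) //= !mxE !eqxx mul1r mulr1.
  by rewrite big1 ?addr0 // => k kj; rewrite !mxE (negbTE kj) mulr0.
rewrite mxE mulr1n; apply.
apply/negP => /eqP /(congr1 (mulmx U^T)); rewrite mulmxA UtU mul1mx mulmx0.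
by move/matrixP => /(_ j 0); rewrite !mxE !eqxx; apply/eqP; exact: oner_neq0.
Qed.

(** The diagonal matrix is unitarily similar to a product that factors through dimension [r]. *)
Lemma lambda_eq0 (j : 'I_(m * K)) : (r <= j)%N -> lambda 0 j = 0.
Proof.
move=> rj; apply: rank_sorted_diag lambda_ord _; apply: leq_trans rj.
rewrite -(mxrank_map (real_complex R)) -/(cplx_mx _).
have -> : cplx_mx (diag_mx lambda) = V ^t* *m (H ^t* *m invmx S *m H) *m V.
  by rewrite H_evd !mulmxA VtV mul1mx -mulmxA VtV mulmx1.
apply: leq_trans (mxrankM_maxl _ _) _; apply: leq_trans (mxrankM_maxr _ _) _.
by apply: leq_trans (mxrankM_maxr _ _) _; exact: rank_leq_row.
Qed.

Section Precoder.
Context (phi : 'rV[R[i]]_(m * K)) (x : 'I_(m * K) -> R).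
Hypothesis phix : forall i, `|phi 0 i| ^+ 2 = (x i)%:C.

Lemma sqr_modulus_ge0 i : 0 <= x i.
Proof. by rewrite -lecR -phix exprn_ge0. Qed.

(** [V] cancels against the eigenbasis of the channel, and the phases of [phi] cancel against their
    conjugates, leaving a real matrix diagonal in [U]. *)
Lemma precoder_gram :
  (precoder U V phi) ^t* *m H ^t* *m invmx S *m H *m precoder U V phi
  = cplx_mx (U *m diag_mx (\row_j \sum_i lambda 0 i * x i *+ (i == j :> nat))
             *m U^T).
Proof.
rewrite -(mulmxA _ _ (invmx S)) -(mulmxA _ _ H) H_evd /precoder.
rewrite !trmx_mul !map_mxM /= trmxK conjU.
rewrite !mulmxA -(mulmxA _ (V ^t*) V) VtV mulmx1.
rewrite -(mulmxA _ (V ^t*) V) VtV mulmx1.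
rewrite !cplx_mxM cplx_mx_tr; congr (_ *m _).
rewrite -!mulmxA; congr (_ *m _); rewrite mulmxA.
apply/matrixP => a b; rewrite /cplx_mx map_diag_mx mul_mx_diag !mxE.
rewrite -sumrMnl rmorph_sum; apply: eq_bigr => i _.
rewrite !mxE !rmorphMn /= rmorphM /= -phix normCKC.
case: (eqVneq (i : nat) a) => [->|ia].
  by rewrite !mulr1n mulrnAr -val_eqE mulrA (mulrC (conjc _)).
by rewrite !mulr0n !mul0r mul0rn.
Qed.

(** Both summands under the inverse are diagonal in [U], so inversion is entrywise. Indices beyond
    [m * K] carry no signal and give the constant first sum. *)
Lemma mse_precoder :
  mse Kcov S H (precoder U V phi)
  = (\sum_(j < n * K | ~~ (j < m * K)%N) delta 0 j * Rgain U j
     + \sum_i del i * gain i / (1 + del i * lambda 0 i * x i))%:C.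
Proof.
pose e : 'rV[R]_(n * K) := \row_j ((delta 0 j)^-1
  + \sum_i lambda 0 i * x i *+ (i == j :> nat)).
have e0 j : e 0 j != 0.
  rewrite mxE gt_eqF // ltr_wpDr ?invr_gt0 ?delta_gt0 //.
  apply: sumr_ge0 => i _; rewrite mulrn_wge0 // mulr_ge0 ?sqr_modulus_ge0 //.
  by case: lambda_ord.
rewrite /mse precoder_gram Kcov_evd.
have -> : invmx (cplx_mx (U *m diag_mx delta *m U^T))
    = cplx_mx (invmx (U *m diag_mx delta *m U^T)) by rewrite [RHS]map_invmx.
rewrite invmx_orthogonal_diag // => [|j]; last by rewrite gt_eqF ?delta_gt0.
rewrite -raddfD -mulmxDl -mulmxDr -raddfD /=.
set E := (_ + _ : 'rV_(n * K)).
have -> : E = e by apply/rowP => j; rewrite !mxE.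
rewrite -[invmx _]map_invmx -/(cplx_mx _) invmx_orthogonal_diag //.
rewrite -cplx_mx_tr -!cplx_mxM [LHS]trace_map_mx trace_sandwich_diag.
congr (real_complex R _).
(* Error in direction [j] as a function of the signal strength [y]; at 0 it is the prior value
   [delta 0 j * Rgain U j]. *)
pose f j y := ((delta 0 j)^-1 + y)^-1 * Rgain U j.
rewrite (eq_bigr (fun j => f j (\sum_i lambda 0 i * x i *+ (i == j :> nat))));
  last by move=> j _; rewrite !mxE.
rewrite (sum_widen_ord (leq_mul hmn (leqnn K))) //; congr (_ + _).
  by apply: eq_bigr => j _; rewrite /f addr0 invrK.
apply: eq_bigr => i _; rewrite /f -/(node_ord hmn i).
have d0 := delta_gt0 (node_ord hmn i).
have l0 : 0 <= lambda 0 i by case: lambda_ord.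
have x0 := sqr_modulus_ge0 i.
have : 0 < 1 + del i * lambda 0 i * x i.
  by rewrite ltr_wpDr // !mulr_ge0 // ltW.
by move=> y0; field; rewrite !gt_eqF.
Qed.

Lemma power_precoder :
  power Kcov (precoder U V phi) = (\sum_i del i * x i)%:C.
Proof.
have WtW : (cplx_mx U)^T *m cplx_mx U = 1%:M.
  by rewrite -cplx_mx_tr -cplx_mxM UtU [LHS]map_mx1.
rewrite /power /precoder Kcov_evd !cplx_mxM !trmx_mul !map_mxM /= trmxK conjU.
rewrite cplx_mx_tr !mulmxA -(mulmxA _ _ (cplx_mx U)) WtW mulmx1.
rewrite -(mulmxA _ _ (cplx_mx U)) WtW mulmx1 mxtrace_mulC !mulmxA.
rewrite VtV mul1mx /cplx_mx map_diag_mx mul_mx_diag rmorph_sum.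
apply: eq_bigr => i _; rewrite mxE (bigD1 (node_ord hmn i)) //= big1 ?addr0.
  by rewrite !mxE eqxx !mulr1n mulrAC -normCK phix rmorphM mulrC.
move=> j; rewrite -val_eqE /= => /negbTE ji.
by rewrite !mxE eq_sym ji !mul0r.
Qed.

End Precoder.
End Model.

(** * Return from squared moduli to precoders *)

Section Solution.
Context (R : realType) (K m n r : nat) (hmn : (m <= n)%N) (P0 : R).
Context (Kcov : 'M[R]_(n * K)) (S : 'M[R[i]]_r) (H : 'M[R[i]]_(r, m * K)).
Context (U : 'M[R]_(n * K)) (delta : 'rV[R]_(n * K)).
Context (V : 'M[R[i]]_(m * K)) (lambda : 'rV[R]_(m * K)).
Hypotheses (Kcov_pd : real_posdef Kcov)
  (U_unitary : cplx_mx U \is unitarymx) (V_unitary : V \is unitarymx)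
  (lambda_ord : nonincreasing_nonneg lambda)
  (Kcov_evd : Kcov = U *m diag_mx delta *m U^T)
  (H_evd : H ^t* *m invmx S *m H
           = V *m cplx_mx (diag_mx lambda) *m V ^t*).

Local Notation del i := (delta 0 (node_ord hmn i)).
Local Notation gain i := (Rgain U (node_ord hmn i)).
Local Notation level mu i := (wf_level (del i) (lambda 0 i) (gain i) mu).
Local Notation sqr_modulus phi i :=
  (complex.Re (phi 0 i) ^+ 2 + complex.Im (phi 0 i) ^+ 2).

Let del_gt0 i : 0 < del i.
Proof. exact: delta_gt0 Kcov_pd U_unitary Kcov_evd _. Qed.

Let lambda_ge0 i : 0 <= lambda 0 i.
Proof. by case: lambda_ord. Qed.

Let gain_ge0 i : 0 <= gain i.
Proof. by apply: sumr_ge0 => j _; exact: sqr_ge0. Qed.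

Let modulusE (phi : 'rV[R[i]]_(m * K)) i :
  `|phi 0 i| ^+ 2 = (sqr_modulus phi i)%:C.
Proof. by rewrite add_Re2_Im2. Qed.

(** Beyond the cut-off [lambda] vanishes, and the uniform formula then gives 0 by itself. *)
Lemma wf_sqrE mu j : wf_sqr r hmn delta lambda U mu j = level mu j.
Proof.
rewrite /wf_sqr; case: ifP => // /negbT; rewrite leq_min ltn_ord andbT -leqNgt.
by move=> /(lambda_eq0 V_unitary lambda_ord H_evd) ->; rewrite wf_level_l0.
Qed.

Lemma level_ge0 mu j : 0 <= level mu j.
Proof. by rewrite wf_level_ge0 // ltW. Qed.

Lemma is_waterfillingP mu phi :
  is_waterfilling r hmn delta lambda U mu phi
  <-> forall j, sqr_modulus phi j = level mu j.
Proof.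
split=> wf j; first by apply: complexI; rewrite -modulusE wf wf_sqrE.
by rewrite modulusE wf wf_sqrE.
Qed.

Lemma feasibleP phi :
  feasible P0 Kcov U V phi <-> \sum_i del i * sqr_modulus phi i = P0.
Proof.
rewrite /feasible.
rewrite (power_precoder hmn U_unitary V_unitary Kcov_evd (modulusE phi)).
by split=> [/complexI|->].
Qed.

Lemma waterfilling_exists mu :
  exists phi, is_waterfilling r hmn delta lambda U mu phi.
Proof.
exists (\row_j (Num.sqrt (level mu j))%:C) => j.
by rewrite mxE normsqr_sqrt ?level_ge0 // wf_sqrE.
Qed.

(** [water_level] quantifies over all water-filling vectors; the existence of one keeps it from
    being vacuous. *)
Lemma water_levelP mu :
  water_level r hmn delta lambda U P0 Kcov V mu
  <-> 0 < mu /\ \sum_i del i * level mu i = P0.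
Proof.
split=> -[mu0 muP]; split=> //.
  have [phi wf] := waterfilling_exists mu; have /feasibleP <- := muP _ wf.
  by move/is_waterfillingP: wf => wf; apply: eq_bigr => i _; rewrite wf.
move=> phi /is_waterfillingP wf; apply/feasibleP; rewrite -[RHS]muP.
by apply: eq_bigr => i _; rewrite wf.
Qed.

Lemma water_level_unique :
  0 < P0 -> (exists j, 0 < lambda 0 j * gain j) ->
  exists! mu, water_level r hmn delta lambda U P0 Kcov V mu.
Proof.
move=> P0_gt0 lg.
have [mu mu0 muP] := level_sum_exists del_gt0 lambda_ge0 gain_ge0 P0_gt0 lg.
exists mu; split=> [|nu /water_levelP[nu0 nuP]]; first exact/water_levelP.
exact: (level_sum_inj del_gt0 lambda_ge0 gain_ge0 P0_gt0).
Qed.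

Lemma mse_waterfilling mu phi psi :
  water_level r hmn delta lambda U P0 Kcov V mu ->
  is_waterfilling r hmn delta lambda U mu phi -> feasible P0 Kcov U V psi ->
  mse Kcov S H (precoder U V phi) <= mse Kcov S H (precoder U V psi)
    ?= iff [forall j, sqr_modulus psi j == level mu j].
Proof.
move=> /water_levelP[mu0 muP] /is_waterfillingP wf /feasibleP psiP.
rewrite !(mse_precoder hmn Kcov_pd U_unitary V_unitary lambda_ord Kcov_evd H_evd
  (modulusE _)) /Order.leif lecR (inj_eq (@complexI _)).
rewrite lerD2l (inj_eq (addrI _)).
under [X in X <= _]eq_bigr do rewrite wf.
under [X in X == _]eq_bigr do rewrite wf.
apply: (level_sum_minP del_gt0 lambda_ge0 gain_ge0 mu0 muP _ psiP) => i.
by rewrite addr_ge0 ?sqr_ge0.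
Qed.

(** For the forward direction, a solution does no worse than some water-filling vector, so the
    equality case of [mse_waterfilling] fixes its moduli. *)
Lemma is_solutionP mu phi :
  water_level r hmn delta lambda U P0 Kcov V mu ->
  is_solution P0 Kcov S H U V phi
  <-> is_waterfilling r hmn delta lambda U mu phi.
Proof.
move=> lvl; split=> [[phiP opt]|wf]; last first.
  by split=> [|psi psiP]; [exact: lvl.2 | exact: mse_waterfilling lvl wf psiP].
have [psi wf] := waterfilling_exists mu.
have le := mse_waterfilling lvl wf phiP.
apply/is_waterfillingP => j; apply/eqP; move: j; apply/forallP.
by rewrite -(ge_leif le); apply: opt; exact: lvl.2.
Qed.

(** With no term cut off, the power constraint is affine in 1 / sqrt mu and can be solved for it. *)
Lemma closed_form_solution mu :
  (0 < m * K)%N -> (0 < r)%N ->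
  water_level r hmn delta lambda U P0 Kcov V mu ->
  (forall j : 'I_(m * K), (j < minn r (m * K))%N ->
     0 <= wf_inner hmn delta lambda U mu j) ->
  wf_closed r hmn delta lambda U P0
  = \row_j (Num.sqrt (level mu j))%:C.
Proof.
move=> mK0 r0 /water_levelP[mu0 muP] inner_ge0.
pose a j := Num.sqrt (del j * lambda 0 j * gain j).
have s0 : 0 < Num.sqrt mu by rewrite sqrtr_gt0.
have innerE j : wf_inner hmn delta lambda U mu j = a j / Num.sqrt mu - 1.
  by rewrite /wf_inner sqrtrM ?sqrtrV ?mulr_ge0 // ltW.
(* A nonnegative inner term means [a j] is at least sqrt mu; hence [lambda 0 j] is positive and the
   divisions below are genuine. *)
have a_gt0 (j : 'I_(m * K)) : (j < minn r (m * K))%N -> 0 < a j.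
  move=> jr; have := inner_ge0 j jr; rewrite innerE subr_ge0 ler_pdivlMr //.
  by rewrite mul1r; exact: lt_le_trans.
have lambda_gt0 (j : 'I_(m * K)) : (j < minn r (m * K))%N -> 0 < lambda 0 j.
  move=> /a_gt0; rewrite sqrtr_gt0 => dlg; rewrite lt_def lambda_ge0 andbT.
  by apply: contraTneq dlg => ->; rewrite mulr0 mul0r ltxx.
have sqrtE (j : 'I_(m * K)) : (j < minn r (m * K))%N ->
    Num.sqrt (del j * gain j / lambda 0 j) = a j / lambda 0 j.
  move=> /lambda_gt0 l0; rewrite /a.
  have -> : del j * gain j / lambda 0 j
      = del j * lambda 0 j * gain j / lambda 0 j ^+ 2.
    by field; rewrite gt_eqF.
  rewrite sqrtrM ?sqrtrV ?sqr_ge0 ?sqrtr_sqr ?ger0_norm //.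
  by rewrite !mulr_ge0 // ltW.
(* An index in range, so that the denominator of the closed form is a nonempty sum of positive
   terms. *)
pose j0 := Ordinal mK0.
have j0r : (j0 < minn r (m * K))%N by rewrite leq_min r0.
have sum_gt0 : 0 < \sum_(l < m * K | (l < minn r (m * K))%N)
    Num.sqrt (del l * gain l / lambda 0 l).
  rewrite (bigD1 j0) //= ltr_wpDr //; last first.
    by rewrite sqrtE // divr_gt0 ?a_gt0 ?lambda_gt0.
  by apply: sumr_ge0 => l _; exact: sqrtr_ge0.
(* The fraction in the closed form is 1 / sqrt mu: multiply out and substitute the power constraint
   for [P0]. *)
have ratioE : (P0 + \sum_(l < m * K | (l < minn r (m * K))%N) 1 / lambda 0 l) /
     (\sum_(l < m * K | (l < minn r (m * K))%N)
        Num.sqrt (del l * gain l / lambda 0 l)) = (Num.sqrt mu)^-1.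
  apply: (mulIf (lt0r_neq0 sum_gt0)); rewrite divfK ?gt_eqF //.
  rewrite -muP (bigID (fun l : 'I__ => (l < minn r (m * K))%N)) /=.
  rewrite [X in _ + X + _]big1 => [|l]; last first.
    rewrite -wf_sqrE /wf_sqr => /negbTE ->; exact: mulr0.
  rewrite addr0 -big_split /= mulr_sumr; apply: eq_bigr => l lr.
  have l0 := lambda_gt0 _ lr.
  rewrite mul_wf_level // -/(a l) max_r -?innerE ?inner_ge0 // sqrtE // innerE.
  by field; rewrite !gt_eqF.
apply/rowP => j; rewrite !mxE; case: ifP => [jr|jr].
  rewrite ratioE -innerE /wf_level -/(wf_inner hmn delta lambda U mu j).
  by rewrite max_r ?inner_ge0.
by rewrite -wf_sqrE /wf_sqr jr sqrtr0.
Qed.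

End Solution.

Theorem theorem1 (R : realType) (K m n r : nat)
    (K_gt0 : (0 < K)%N) (m_gt0 : (0 < m)%N) (n_gt0 : (0 < n)%N)
    (r_gt0 : (0 < r)%N) (hmn : (m <= n)%N)
    (P0 : R) (P0_gt0 : 0 < P0)
    (Kcov : 'M[R]_(n * K)) (Kcov_pd : real_posdef Kcov)
    (S : 'M[R[i]]_r) (S_pd : cplx_posdef S)
    (H : 'M[R[i]]_(r, m * K))
    (U : 'M[R]_(n * K)) (delta : 'rV[R]_(n * K))
    (V : 'M[R[i]]_(m * K)) (lambda : 'rV[R]_(m * K))
    (U_unitary : cplx_mx U \is unitarymx)
    (V_unitary : V \is unitarymx)
    (delta_ord : nonincreasing_nonneg delta)
    (lambda_ord : nonincreasing_nonneg lambda)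
    (Kcov_evd : Kcov = U *m diag_mx delta *m U^T)
    (H_evd : H ^t* *m invmx S *m H
             = V *m cplx_mx (diag_mx lambda) *m V ^t*) :
  [/\ (exists j : 'I_(m * K), 0 < lambda 0 j * Rgain U (node_ord hmn j)) ->
        exists! mu : R, water_level r hmn delta lambda U P0 Kcov V mu,
      forall mu : R, water_level r hmn delta lambda U P0 Kcov V mu ->
        forall phi : 'rV[R[i]]_(m * K),
          is_solution P0 Kcov S H U V phi <->
          is_waterfilling r hmn delta lambda U mu phi
    & forall mu : R, water_level r hmn delta lambda U P0 Kcov V mu ->
        (forall j : 'I_(m * K), (j < minn r (m * K))%N ->
           0 <= wf_inner hmn delta lambda U mu j) ->
        is_solution P0 Kcov S H U V (wf_closed r hmn delta lambda U P0) /\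
        forall phi : 'rV[R[i]]_(m * K), is_solution P0 Kcov S H U V phi ->
          forall j, `|phi 0 j| = wf_closed r hmn delta lambda U P0 0 j].
Proof.
have lvlE :=
  is_solutionP Kcov_pd U_unitary V_unitary lambda_ord Kcov_evd H_evd.
split=> [|mu lvl phi|mu lvl inner_ge0].
- exact: water_level_unique Kcov_pd U_unitary V_unitary lambda_ord Kcov_evd
    H_evd P0_gt0.
- exact: lvlE.
have mK0 : (0 < m * K)%N by rewrite muln_gt0 m_gt0.
have -> := closed_form_solution Kcov_pd U_unitary V_unitary lambda_ord Kcov_evd
  H_evd mK0 r_gt0 lvl inner_ge0.
have lev0 := level_ge0 hmn Kcov_pd U_unitary lambda_ord Kcov_evd mu.
have lvlsE := wf_sqrE hmn U delta V_unitary lambda_ord H_evd mu.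
split=> [|phi /(lvlE _ _ _ _ lvl) wf j].
  apply/(lvlE _ _ _ _ lvl) => j.
  by rewrite mxE normsqr_sqrt ?lev0 // lvlsE.
(* Both sides are nonnegative in [R[i]], so comparing squares suffices. *)
rewrite mxE; apply/eqP; rewrite -(@eqrXn2 _ 2) ?normr_ge0 ?ler0c ?sqrtr_ge0 //.
by rewrite wf -rmorphXn /= sqr_sqrtr ?lev0 // lvlsE.
Qed.
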